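(* Let $w\in S_n$ be fireworks. Then the support of $\mathfrak{G}_w^{\mathrm{top}}$ is exactly $\{\mathrm{wt}(\overline{D(w)})\}$.
   Context: Permutations act on the right; $s_j$ swaps positions $j,j+1$. With $\partial_j f=\frac{f-s_jf}{x_j-x_{j+1}}$ ($s_jf$ swaps $x_j,x_{j+1}$) and $\overline{\partial}_j f=\partial_j((1-x_{j+1})f)$, the Grothendieck polynomial is defined by $\mathfrak{G}_{w_0}=x_1^{n-1}\cdots x_{n-1}$ for $w_0=n(n-1)\cdots1$ and $\mathfrak{G}_w=\overline{\partial}_j\mathfrak{G}_{ws_j}$ when $w(j)<w(j+1)$. $\mathfrak{G}_w^{\mathrm{top}}$ denotes the highest-degree nonzero homogeneous component of $\mathfrak{G}_w$; the support of a polynomial is the set of exponent vectors with nonzero coefficient. A permutation is fireworks if the initial elements of its decreasing runs (maximal consecutive decreasing segments of the one-line notation) occur in increasing order. The Rothe diagram is $D(w)=\{(i,j)\in[n]^2: i<w^{-1}(j),\ j<w(i)\}$ ($i$ row, $j$ column); the upper closure of a diagram $D$ is $\overline{D}=\{(i,j): i\le i' \text{ for some }(i',j)\in D\}$, and $\mathrm{wt}(D)\in\mathbb{Z}^n$ has $i$-th entry the number of boxes of $D$ in row $i$. *)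

(* Defs.v *)
From HB Require Import structures.
From mathcomp Require Import all_boot all_order all_algebra all_fingroup.
From mathcomp Require Import mpoly.
From Stdlib Require Import ClassicalEpsilon.

Set Implicit Arguments.
Unset Strict Implicit.
Unset Printing Implicit Defensive.

Import GRing.Theory.
Local Open Scope ring_scope.

(* Conventions: everything is 0-indexed.  Position/value i : 'I_n stands
   for i+1 in the paper; variable 'X_i stands for x_{i+1}.
   A permutation w : 'S_n is identified with its one-line notation
   w 0, w 1, ..., w (n-1). *)

Section Grothendieck.
Variable n : nat.

Notation poly := {mpoly int[n]}.

(* the successor position j+1 (only meaningful when j.+1 < n) *)
Definition nxt (j : 'I_n) : 'I_n := insubd j j.+1.

Definition swapv (j : 'I_n) (f : poly) : poly := msym (tperm j (nxt j)) f.

Definition ddiff (j : 'I_n) (f : poly) : poly :=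
  epsilon (inhabits 0) (fun g : poly => ('X_j - 'X_(nxt j)) * g = f - swapv j f).

Definition ddiffbar (j : 'I_n) (f : poly) : poly := ddiff j ((1 - 'X_(nxt j)) * f).

(* right action: (w s_j)(i) = w (s_j i), i.e. swap positions j, j+1 in the
   one-line notation.  In mathcomp (s * t) x = t (s x). *)
Definition rsj (w : 'S_n) (j : 'I_n) : 'S_n := (tperm j (nxt j) * w)%g.

Definition ascent (w : 'S_n) (j : 'I_n) : bool := (j.+1 < n)%N && (w j < w (nxt j))%N.

Definition xdelta : poly := 'X_[ [multinom (n - 1 - i)%N | i < n] ].

(* G_w = dbar_j G_{w s_j} for an ascent j (the paper's definition; the
   result does not depend on the chosen ascent).  We choose the ascent
   given by [pick].  The recursion terminates at w0 (no ascents) after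
   at most binomial(n,2) <= n*n steps; fuel is n*n. *)
Fixpoint groth_aux (k : nat) (w : 'S_n) : poly :=
  match k with
  | 0 => xdelta
  | k'.+1 => match [pick j | ascent w j] with
             | Some j => ddiffbar j (groth_aux k' (rsj w j))
             | None => xdelta
             end
  end.

Definition groth (w : 'S_n) : poly := groth_aux (n * n) w.

Definition topcomp (p : poly) : poly :=
  \sum_(m <- msupp p | mdeg m == (msize p).-1) p@_m *: 'X_[m].

(* fireworks: initial elements of decreasing runs increase.
   Position i starts a decreasing run iff i = 0 or w(i-1) < w(i). *)
Definition run_start (w : 'S_n) (i : 'I_n) : bool :=
  (i == 0 :> nat) || [exists k : 'I_n, (k.+1 == i :> nat) && (w k < w i)%N].

Definition fireworks (w : 'S_n) : bool :=
  [forall i : 'I_n, forall i' : 'I_n,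
     (run_start w i && run_start w i' && (i < i')%N) ==> (w i < w i')%N].

(* Rothe diagram D(w) = {(i,j) : i < w^{-1}(j), j < w(i)}  (row i, column j) *)
Definition rothe (w : 'S_n) : {set 'I_n * 'I_n} :=
  [set ij : 'I_n * 'I_n | ((ij.1 < (w^-1)%g ij.2)%N && (ij.2 < w ij.1)%N)].

Definition upclosure (D : {set 'I_n * 'I_n}) : {set 'I_n * 'I_n} :=
  [set ij : 'I_n * 'I_n | [exists i' : 'I_n, (ij.1 <= i')%N && ((i', ij.2) \in D)]].

Definition wt (D : {set 'I_n * 'I_n}) : 'X_{1..n} :=
  [multinom #|[set j : 'I_n | (i, j) \in D]| | i < n].

End Grothendieck.

(* Main.v *)
Require Import Defs.
From HB Require Import structures.
From mathcomp Require Import all_boot all_order all_algebra all_fingroup.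
From mathcomp Require Import mpoly.
From mathcomp Require Import zify ring.
From Stdlib Require Import ClassicalEpsilon.

(** A Grothendieck polynomial is the coefficient of [w] in a product of row
    factors [A_0(x_0) A_1(x_1) ...] over the 0-Hecke algebra, where
    [A_j(x) = (1 + x T_{n-2}) ... (1 + x T_j)]: the Yang-Baxter relation makes
    [A_j(x)] and [A_j(y)] commute, and this symmetry is exactly the divided
    difference recursion.  Since [T_k^2 = - T_k], coefficients alternate in sign
    with the degree, so a monomial survives as soon as one (nonreduced) pipe
    dream contributes to it.

    Upper bound: unfolding the recursion along first ascents shows that, for
    every [w], each monomial of [G_w] divides [x^b] with
    [b = wt(upclosure(rothe w))]; [b_i] counts the positions [p > i] that are not
    left-to-right maxima of [w_i w_{i+1} ...].

    For fireworks [w], [b_i] is the number of descents at positions [>= i], and a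
    pipe dream of weight [b] is built row by row: row [i] crosses exactly the
    values that do not start a decreasing run, and removing it leaves a fireworks
    permutation of the remaining positions with the same descents. *)

Set Implicit Arguments.
Unset Strict Implicit.
Unset Printing Implicit Defensive.

Import Order.TTheory GRing.Theory Num.Theory.
Local Open Scope ring_scope.

(** * The 0-Hecke algebra acting on its coefficient functions *)

Section ZeroHecke.
Variables (N : nat) (R : comNzRingType).
Implicit Types (w : 'S_N.+1) (F : {ffun 'S_N.+1 -> R}) (x y : R) (k l : nat).

Definition gen k : 'S_N.+1 := tperm (inord k) (inord k.+1).

(** Positions and values are handled as natural numbers at most [N], so that successors and
    comparisons need no ordinal casts. *)
Definition pos w k : nat := (w^-1)%g (inord k).

Lemma genK k : (gen k * gen k = 1)%g. Proof. exact: tperm2. Qed.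

Lemma genV k : ((gen k)^-1 = gen k)%g. Proof. exact: tpermV. Qed.

Lemma inord_inj k l : (k <= N)%N -> (l <= N)%N ->
  (inord k == inord l :> 'I_N.+1) = (k == l).
Proof. by move=> hk hl; rewrite -val_eqE /= !inordK. Qed.

Lemma gen_inord k l : (k < N)%N -> (l <= N)%N ->
  gen k (inord l) = inord (if l == k then k.+1 else if l == k.+1 then k else l).
Proof.
move=> hk hl; rewrite /gen; case: (l =P k) => [->|/eqP nlk]; first by rewrite tpermL.
case: (l =P k.+1) => [->|/eqP nlk1]; first by rewrite tpermR.
by rewrite tpermD // inord_inj 1?eq_sym //; lia.
Qed.

Lemma pos_gen w k l : (k < N)%N -> (l <= N)%N ->
  pos (w * gen k)%g l =
  if l == k then pos w k.+1 else if l == k.+1 then pos w k else pos w l.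
Proof.
move=> hk hl; rewrite /pos invMg permM genV gen_inord //.
by case: ifP => // _; case: ifP.
Qed.

Lemma pos_inj w k l : (k <= N)%N -> (l <= N)%N -> pos w k = pos w l -> k = l.
Proof.
move=> hk hl /val_inj /perm_inj /eqP; rewrite inord_inj //; exact/eqP.
Qed.

Lemma gen_braid k : (k.+1 < N)%N ->
  (gen k * gen k.+1 * gen k = gen k.+1 * gen k * gen k.+1)%g.
Proof.
move=> hk.
transitivity (gen k.+1 ^ gen k)%g; first by rewrite conjgE genV mulgA.
transitivity (gen k ^ gen k.+1)%g; last by rewrite conjgE genV mulgA.
rewrite {1}/gen tpermJ {3}/gen tpermJ !gen_inord; try lia.
rewrite !eqxx (ltn_eqF (ltnSn k)) !ifF; try lia.
done.
Qed.

Lemma gen_comm k l : (k.+1 < l < N)%N -> (gen k * gen l = gen l * gen k)%g.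
Proof.
move=> hk; have: (gen k ^ gen l = gen k)%g.
  by rewrite {1}/gen tpermJ !gen_inord ?ifF //; lia.
by rewrite conjgE genV => h; rewrite -{2}h !mulgA genK mul1g.
Qed.

(* A function [F] stands for the element [\sum_w F w *: w] of the 0-Hecke algebra;
   [heckeT k] is left multiplication by [T_k], which acts on values because
   mathcomp composes permutations from left to right. *)
Definition heckeT k F : {ffun 'S_N.+1 -> R} :=
  [ffun w => if (pos w k.+1 < pos w k)%N then F (w * gen k)%g - F w else 0].

Definition heckeh k x F : {ffun 'S_N.+1 -> R} :=
  [ffun w => F w + x * heckeT k F w].

Lemma heckeh_comm k l x y F : (k.+1 < l < N)%N ->
  heckeh k x (heckeh l y F) = heckeh l y (heckeh k x F).
Proof.
move=> hk; apply/ffunP=> w.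
have E1 : (l == k) = false by lia. have E2 : (l == k.+1) = false by lia.
have E3 : (l.+1 == k) = false by lia. have E4 : (l.+1 == k.+1) = false by lia.
rewrite !ffunE !pos_gen; [|lia..].
rewrite ?(E1, E2, E3, E4) -?(eq_sym l) -?(eq_sym l.+1) ?(E1, E2, E3, E4).
rewrite -!mulgA (gen_comm hk).
by case: ifP => _; case: ifP => _; ring.
Qed.

Lemma heckeh_commx k x y F : (k < N)%N ->
  heckeh k x (heckeh k y F) = heckeh k y (heckeh k x F).
Proof.
move=> hk; apply/ffunP=> w.
have E : (k.+1 == k) = false by lia.
rewrite !ffunE !pos_gen; [|lia..].
rewrite !eqxx E -!mulgA genK mulg1.
case: ifP => h; [rewrite ifF|]; [ring| |ring].
by apply/negbTE; rewrite -leqNgt ltnW.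
Qed.

(* The symmetric cofactor in [h_k(x) h_(k+1)(y) h_k(y) = h_(k+1)(y) Q(x, y)], a
   division-free form of the Yang-Baxter equation. *)
Definition heckeQ k x y F : {ffun 'S_N.+1 -> R} :=
  [ffun w => F w + (x + y - x * y) * heckeT k F w
     + x * y * (heckeT k (heckeT k.+1 F) w - heckeT k.+1 (heckeT k F) w)].

Lemma heckeQC k x y F : heckeQ k x y F = heckeQ k y x F.
Proof. by apply/ffunP=> w; rewrite !ffunE; ring. Qed.

Lemma heckeh_braid k x y F : (k.+1 < N)%N ->
  heckeh k x (heckeh k.+1 y (heckeh k y F)) = heckeh k.+1 y (heckeQ k x y F).
Proof.
move=> hk; apply/ffunP=> w.
have E1 : (k.+1 == k) = false by lia.
have E2 : (k.+2 == k) = false by lia.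
have E3 : (k.+2 == k.+1) = false by lia.
have hbc : pos w k.+1 <> pos w k.+2 by move=> /pos_inj; lia.
have hac : pos w k <> pos w k.+2 by move=> /pos_inj; lia.
have hab : pos w k <> pos w k.+1 by move=> /pos_inj; lia.
have e1 : (w * gen k.+1 * gen k * gen k.+1 = w * gen k * gen k.+1 * gen k)%g.
  by rewrite -!mulgA; congr (_ * _)%g; rewrite !mulgA gen_braid.
have e2 u : (u * gen k * gen k = u)%g by rewrite -mulgA genK mulg1.
have e3 u : (u * gen k.+1 * gen k.+1 = u)%g by rewrite -mulgA genK mulg1.
rewrite !ffunE !pos_gen; [|lia..].
rewrite !(eq_sym k) !(eq_sym k.+1 k.+2) !eqxx !(E1, E2, E3).
rewrite !(e1, e2, e3).
(* Only the relative order of the three positions matters; each of the six orders leaves a ring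
   identity. *)
move: (pos w k) (pos w k.+1) (pos w k.+2) hbc hac hab => a b c hbc hac hab.
have [h1|h1] := ltnP b a; [have h1' : (a < b)%N = false by lia|have h1' : (a < b)%N by lia];
(have [h2|h2] := ltnP c a; [have h2' : (a < c)%N = false by lia|have h2' : (a < c)%N by lia]);
(have [h3|h3] := ltnP c b; [have h3' : (b < c)%N = false by lia|have h3' : (b < c)%N by lia]);
try (by exfalso; lia);
by rewrite ?h1 ?h2 ?h3 ?h1' ?h2' ?h3' /=; ring.
Qed.

Lemma gen_val k (i : 'I_N.+1) : (k < N)%N ->
  gen k i = (if i == k :> nat then k.+1 else if i == k.+1 :> nat then k else i) :> nat.
Proof.
move=> hk; have hi := ltn_ord i; rewrite ltnS in hi.
by rewrite -{1}(inord_val i) gen_inord // inordK //; repeat case: ifP => _; lia.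
Qed.

(** [foldl] applies the head of [ks] first, so on [iota j (N - j)] this is left multiplication by
    the row factor [A_j(x)], with [1 + x T_j] rightmost. *)
Definition hecke_row ks x F := foldl (fun F k => heckeh k x F) F ks.

Lemma hecke_row_comm_far k ks x y F : all (fun l => k.+1 < l < N)%N ks ->
  heckeh k x (hecke_row ks y F) = hecke_row ks y (heckeh k x F).
Proof.
elim: ks F => [|l ks IH] F //= /andP[hl hks].
by rewrite IH // heckeh_comm.
Qed.

(** The factor at [j] of the left row slides past the far factors of the right row, and
    [heckeh_braid] absorbs it into a cofactor symmetric in [x] and [y]. What remains are two rows
    starting at [j.+1], handled by induction. *)
Lemma hecke_rowC j m x y F : (j + m <= N)%N ->
  hecke_row (iota j m) x (hecke_row (iota j m) y F) =
  hecke_row (iota j m) y (hecke_row (iota j m) x F).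
Proof.
elim: m j F => [|[|m] IH] j F hj //=; first by rewrite heckeh_commx //; lia.
have hall : all (fun l => (j.+1 < l < N)%N) (iota j.+2 m).
  by apply/allP=> l; rewrite mem_iota; lia.
rewrite !(hecke_row_comm_far _ _ _ hall) !heckeh_braid; try lia.
by rewrite heckeQC; apply: (IH j.+1); lia.
Qed.

(* Right multiplication by [1 + x T_j], acting on positions. *)
Definition heckeh_r j x F : {ffun 'S_N.+1 -> R} :=
  [ffun w => F w + x * (if (w (inord j.+1) < w (inord j))%N
                        then F (gen j * w)%g - F w else 0)].

Lemma pos_eq w i l : (i <= N)%N -> (l <= N)%N ->
  (pos w l == i) = (w (inord i) == l :> nat).
Proof.
move=> hi hl; rewrite /pos -[i in LHS](@inordK N) // -[l in RHS](@inordK N) //.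
by rewrite !val_eqE (canF_eq (permK w)) eq_sym.
Qed.

(** Associativity of the product. The two descent tests interact only if the values [k], [k.+1]
    occupy positions [j], [j.+1], and then [gen j * w = w * gen k]. *)
Lemma heckeh_r_comm j k x y F : (j < N)%N -> (k < N)%N ->
  heckeh_r j x (heckeh k y F) = heckeh k y (heckeh_r j x F).
Proof.
move=> hj hk; apply/ffunP=> w; rewrite !ffunE !permM.
have posl l : pos (gen j * w)%g l =
    (if pos w l == j then j.+1 else if pos w l == j.+1 then j else pos w l) :> nat.
  by rewrite /pos invMg permM genV gen_val.
rewrite !posl !gen_val //.
have e1 := @pos_eq w j k; have e2 := @pos_eq w j k.+1.
have e3 := @pos_eq w j.+1 k; have e4 := @pos_eq w j.+1 k.+1.
have E : [&& w (inord j) == k :> nat & w (inord j.+1) == k.+1 :> nat] ||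
  [&& w (inord j) == k.+1 :> nat & w (inord j.+1) == k :> nat] ->
  (gen j * w = w * gen k)%g.
  move=> h; have -> : gen k = (gen j ^ w)%g.
    rewrite tpermJ; case/orP: h => /andP[/eqP h1 /eqP h2].
      by congr tperm; apply: val_inj; rewrite /= inordK // ltnW.
    by rewrite tpermC; congr tperm; apply: val_inj; rewrite /= inordK // ltnW.
  by rewrite conjgE !mulgA mulgV mul1g.
have nab : w (inord j) <> w (inord j.+1) :> nat.
  by move=> /val_inj/perm_inj/eqP; rewrite inord_inj; lia.
have npq : pos w k <> pos w k.+1 by move=> /pos_inj; lia.
have E' : (gen j * w = w * gen k)%g -> (gen j * w * gen k = w)%g.
  by move=> ->; rewrite -mulgA genK mulg1.
move: (pos w k) (pos w k.+1) (nat_of_ord (w (inord j))) (nat_of_ord (w (inord j.+1)))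
  e1 e2 e3 e4 E nab npq E' => p q a b e1 e2 e3 e4 E nab npq E'.
have {}e1 := e1 (ltnW hj) (ltnW hk). have {}e2 := e2 (ltnW hj) hk.
have {}e3 := e3 hj (ltnW hk). have {}e4 := e4 hj hk.
have L m : (m.+1 < m)%N = false by rewrite ltnNge leqnSn.
case C : ([&& a == k & b == k.+1] || [&& a == k.+1 & b == k]).
  have {E}E := E C; rewrite (E' E) -E.
  case/orP: C => /andP[/eqP ha /eqP hb]; subst a b.
    have hp : p = j by lia. have hq : q = j.+1 by lia.
    by subst p q; rewrite !L !mulr0 !addr0.
  have hp : p = j.+1 by lia. have hq : q = j by lia.
  subst p q; rewrite !eqxx !(gtn_eqF (ltnSn _)) !ltnSn !L.
  by ring.
have -> : ((if b == k then k.+1 else if b == k.+1 then k else b) <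
           (if a == k then k.+1 else if a == k.+1 then k else a))%N = (b < a)%N.
  by move: C nab; clear; repeat case: eqP => ? /=; lia.
have -> : ((if q == j then j.+1 else if q == j.+1 then j else q) <
           (if p == j then j.+1 else if p == j.+1 then j else p))%N = (q < p)%N.
  move: C npq; rewrite -e1 -e2 -e3 -e4.
  by clear; repeat case: eqP => ? /=; lia.
by rewrite mulgA; case: ifP => _; case: ifP => _; ring.
Qed.

(** The unit, on which left and right multiplication by [T_j] agree. *)
Definition delta1 : {ffun 'S_N.+1 -> R} := [ffun w => (w == 1%g)%:R].

Lemma heckeh_r_delta1 j x : (j < N)%N -> heckeh_r j x delta1 = heckeh j x delta1.
Proof.
move=> hj; apply/ffunP=> w; rewrite !ffunE.
have -> : (gen j * w == 1)%g = (w * gen j == 1)%g.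
  by rewrite -(inj_eq (mulgI (gen j))) mulgA genK mul1g mulg1
    -[RHS](inj_eq (mulIg (gen j))) -mulgA genK mulg1 mul1g.
congr (_ + _ * _).
have [->|nw] := eqVneq w (gen j).
  by rewrite /pos genV /gen !tpermL !tpermR.
have -> : (w * gen j == 1)%g = false.
  by apply/negbTE; rewrite -(inj_eq (mulIg (gen j))) -mulgA genK mulg1 mul1g.
have [->|n1] := eqVneq w 1%g; last by rewrite subrr !if_same.
by rewrite /pos invg1 !perm1 !inordK ?ltnS ?(ltnW hj) // ltnNge leqnSn.
Qed.

Definition hecke_prod (ns : seq nat) (t : nat -> R) F :=
  foldr (fun i G => hecke_row (iota i (N - i)) (t i) G) F ns.

Lemma heckeh_r_row j ks x y F : (j < N)%N -> all (fun k => k < N)%N ks ->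
  heckeh_r j x (hecke_row ks y F) = hecke_row ks y (heckeh_r j x F).
Proof.
move=> hj; elim: ks F => [|k ks IH] F //= /andP[hk hks].
by rewrite IH // heckeh_r_comm.
Qed.

Lemma heckeh_r_prod j ns t x F : (j < N)%N ->
  heckeh_r j x (hecke_prod ns t F) = hecke_prod ns t (heckeh_r j x F).
Proof.
move=> hj; elim: ns => [|i ns IH] //=; rewrite heckeh_r_row ?IH //.
by apply/allP=> k; rewrite mem_iota; lia.
Qed.

Lemma heckeh_prod_far j ns t x F : all (fun i => j.+1 < i)%N ns ->
  heckeh j x (hecke_prod ns t F) = hecke_prod ns t (heckeh j x F).
Proof.
elim: ns => [|i ns IH] //= /andP[hi hns].
rewrite hecke_row_comm_far ?IH //.
by apply/allP=> k; rewrite mem_iota; lia.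
Qed.

Lemma eq_hecke_prod ns t t' F : {in ns, t =1 t'} ->
  hecke_prod ns t F = hecke_prod ns t' F.
Proof.
elim: ns => [|i ns IH] //= h; rewrite h ?mem_head // IH // => k hk.
by apply: h; rewrite in_cons hk orbT.
Qed.

Definition hecke_groth t := hecke_prod (iota 0 N.+1) t delta1.

(* The factor [1 + t_(j+1) T_j] commutes through the rows below and completes
   [A_(j+1)(t_(j+1))] to [A_j(t_(j+1))], which commutes with [A_j(t_j)]. *)
Lemma hecke_groth_sym j t t' : (j < N)%N ->
  t j = t' j.+1 -> t j.+1 = t' j ->
  (forall i, (i <= N)%N -> i != j -> i != j.+1 -> t i = t' i) ->
  heckeh_r j (t j.+1) (hecke_groth t) = heckeh_r j (t' j.+1) (hecke_groth t').
Proof.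
(* The right factor slides in to [delta1], where it turns into a left factor. *)
move=> hj tj tj1 tt'; rewrite !heckeh_r_prod // !heckeh_r_delta1 //.
have -> : iota 0 N.+1 = iota 0 j ++ [:: j, j.+1 & iota j.+2 (N - j.+1)].
  have -> : N.+1 = (j + (N - j.+1).+2)%N by lia.
  by rewrite iotaD.
rewrite /hecke_prod !foldr_cat /= -!/(hecke_prod _ _ _).
have hall : all (fun i => j.+1 < i)%N (iota j.+2 (N - j.+1)).
  by apply/allP=> i; rewrite mem_iota; lia.
rewrite -!(heckeh_prod_far _ _ _ hall).
have rowS y F : hecke_row (iota j.+1 (N - j.+1)) y (heckeh j y F) =
    hecke_row (iota j (N - j)) y F.
  by have -> : (N - j = (N - j.+1).+1)%N by lia.
rewrite !rowS hecke_rowC; last by lia.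
rewrite tj tj1 (@eq_hecke_prod (iota j.+2 _) t t'); last first.
  by move=> i; rewrite mem_iota => hi; apply: tt'; lia.
by apply: eq_hecke_prod => i; rewrite mem_iota => hi; apply: tt'; lia.
Qed.

End ZeroHecke.

(** Lets an exchange of variables act on the row parameters alone. *)
Lemma rmorph_hecke_groth N (R S : comNzRingType) (f : {rmorphism R -> S}) t w :
  f (hecke_groth N t w) = hecke_groth N (f \o t) w.
Proof.
have hh k x (F : {ffun 'S_N.+1 -> R}) (G : {ffun 'S_N.+1 -> S}) :
      (forall u, f (F u) = G u) ->
    forall u, f (heckeh k x F u) = heckeh k (f x) G u.
  move=> h u; rewrite !ffunE rmorphD rmorphM -!h.
  by case: ifP => _; rewrite ?rmorphB ?rmorph0.
have hr ks x (F : {ffun 'S_N.+1 -> R}) (G : {ffun 'S_N.+1 -> S}) :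
      (forall u, f (F u) = G u) ->
    forall u, f (hecke_row ks x F u) = hecke_row ks (f x) G u.
  by elim: ks F G => [|k ks IH] F G h //=; apply: IH; apply: hh.
rewrite /hecke_groth; elim: (iota _ _) w => [|i ns IH] w /=; last exact: hr.
by rewrite !ffunE rmorph_nat.
Qed.

(** * Grothendieck polynomials as 0-Hecke coefficients *)

Section Values.
Variable N : nat.
Implicit Types (w : 'S_N.+1) (i j k q : nat).

Definition val_at w q : nat := w (inord q).

Lemma val_at_le w q : (val_at w q <= N)%N.
Proof. by rewrite -ltnS ltn_ord. Qed.

Lemma pos_le w k : (pos w k <= N)%N.
Proof. by rewrite -ltnS ltn_ord. Qed.

Lemma val_at_inj w q q' : (q <= N)%N -> (q' <= N)%N ->
  val_at w q = val_at w q' -> q = q'.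
Proof.
by move=> hq hq' /val_inj/perm_inj/eqP; rewrite inord_inj // => /eqP.
Qed.

Lemma val_at_pos w k : (k <= N)%N -> val_at w (pos w k) = k.
Proof. by move=> hk; rewrite /val_at /pos inord_val permKV inordK. Qed.

Lemma pos_val_at w q : (q <= N)%N -> pos w (val_at w q) = q.
Proof. by move=> hk; rewrite /val_at /pos inord_val permK inordK. Qed.

Lemma val_at_mulgen w k q : (k < N)%N ->
  val_at (w * gen N k)%g q =
  if val_at w q == k then k.+1 else if val_at w q == k.+1 then k else val_at w q.
Proof. by move=> hk; rewrite /val_at permM gen_val. Qed.

Definition fixes i w := forall q, (q < i)%N -> val_at w q = q.

Definition decr_from i w :=
  forall q q', (i <= q)%N -> (q < q')%N -> (q' <= N)%N -> (val_at w q' < val_at w q)%N.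

Lemma fixes_all w : fixes N.+1 w -> w = 1%g.
Proof.
move=> h; apply/permP=> i; apply/val_inj; rewrite perm1 /= -(inord_val i).
by rewrite [LHS](h i) // inord_val.
Qed.

Lemma fixes_pos i w k : fixes i w -> (i <= k <= N)%N -> (i <= pos w k)%N.
Proof.
move=> h /andP[hik hk]; rewrite leqNgt; apply/negP=> hp.
by have := h _ hp; rewrite val_at_pos //; lia.
Qed.

End Values.

(** * The coefficient of the longest element *)

Section LongestElement.
Variables (N : nat) (R : comNzRingType).
Implicit Types (w : 'S_N.+1) (F : {ffun 'S_N.+1 -> R}) (i j k q : nat).

Lemma hecke_row_rcons i m y F :
  hecke_row (iota i m.+1) y F = heckeh (i + m) y (hecke_row (iota i m) y F).
Proof. by rewrite /hecke_row -[m.+1]addn1 iotaD foldl_cat. Qed.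

Lemma heckeh_neq0 k x F w : heckeh k x F w != 0 ->
  F w != 0 \/ (pos w k.+1 < pos w k)%N /\ F (w * gen N k)%g != 0.
Proof.
rewrite !ffunE; have [->|] := eqVneq (F w) 0; last by left.
have [->|] := eqVneq (F (w * gen N k)%g) 0.
  by rewrite subrr if_same mulr0 addr0 eqxx.
by case: ifP => _ h; [right|rewrite mulr0 addr0 eqxx].
Qed.

(** The factors exchange only values [>= i], and each one raises the largest value that can stand at
    position [i] by one. *)
Lemma hecke_row_supp i m y F w : (i + m <= N)%N ->
  (forall u, F u != 0 -> fixes i.+1 u) ->
  hecke_row (iota i m) y F w != 0 -> fixes i w /\ (val_at w i <= i + m)%N.
Proof.
move=> him hF; elim: m w him => [|m IH] w him.
  move=> /hF h; split; last by rewrite h // addn0.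
  by move=> q hq; apply: h; apply: ltnW.
rewrite hecke_row_rcons => /heckeh_neq0[|[_]] /IH[]; try lia.
  by move=> h1 h2; split=> //; lia.
move=> h1 h2; split.
  move=> q hq; have := h1 q hq; rewrite val_at_mulgen; last by lia.
  by repeat case: eqP; lia.
by move: h2; rewrite val_at_mulgen; [repeat case: eqP; lia|lia].
Qed.

Lemma hecke_prod_supp i m t w : (i + m = N.+1)%N ->
  hecke_prod (iota i m) t (delta1 N R) w != 0 -> fixes i w.
Proof.
elim: m i w => [|m IH] i w him.
  rewrite /= ffunE; case: (w =P 1%g) => [-> _ q hq|]; last by rewrite eqxx.
  by rewrite /val_at perm1 inordK //; lia.
by move=> /= /hecke_row_supp[|u|] //; [lia|apply: IH; lia].
Qed.

(** The bound of [hecke_row_supp] is attained, so every factor must cross: the uncrossed terms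
    vanish and each crossing contributes one [y]. *)
Lemma hecke_row_decr i m y c F w : (i + m <= N)%N ->
  (forall u, F u != 0 -> fixes i.+1 u) ->
  (forall u, fixes i.+1 u -> decr_from i.+1 u -> F u = c) ->
  fixes i w -> val_at w i = (i + m)%N -> decr_from i.+1 w ->
  hecke_row (iota i m) y F w = y ^+ m * c.
Proof.
move=> + hF hc; elim: m w => [|m IH] w him hfix hwi hdec.
  rewrite expr0 mul1r; apply: hc => // q; rewrite ltnS leq_eqVlt => /orP[/eqP->|/hfix //].
  by rewrite hwi addn0.
rewrite hecke_row_rcons !ffunE.
have F0 : hecke_row (iota i m) y F w = 0.
  by apply/eqP/negPn/negP => /hecke_row_supp[||_] //; lia.
have hp : pos w (i + m).+1 = i.
  by rewrite -addnS -hwi pos_val_at //; lia.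
have hp' : (i < pos w (i + m))%N.
  have h1 : (i <= pos w (i + m))%N by apply: fixes_pos => //; lia.
  have h2 : pos w (i + m)%N <> i by rewrite -[in RHS]hp => /pos_inj; lia.
  by lia.
rewrite F0 hp hp' add0r subr0 IH ?addn1 ?exprS ?mulrA //; first by lia.
- move=> q hq; rewrite val_at_mulgen ?hfix //; last by lia.
  by repeat case: eqP; lia.
- by rewrite val_at_mulgen ?hwi; [repeat case: eqP; lia|lia].
- move=> q q' h1 h2 h3; have := hdec q q' h1 h2 h3.
  have n1 : val_at w q <> val_at w i by move=> /val_at_inj; lia.
  have n2 : val_at w q' <> val_at w i by move=> /val_at_inj; lia.
  rewrite !val_at_mulgen; try lia.
  by repeat case: eqP; lia.
Qed.

Lemma decr_from_val i w : (i <= N)%N -> fixes i w -> decr_from i w -> val_at w i = N.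
Proof.
move=> hi hfix hdec; have h1 := @fixes_pos _ i w N hfix; rewrite hi leqnn in h1.
have {}h1 := h1 isT; move: h1; rewrite leq_eqVlt => /orP[/eqP->|h].
  exact: val_at_pos.
have := hdec i _ (leqnn i) h (pos_le w N); rewrite val_at_pos //.
by have := val_at_le w i; lia.
Qed.

Lemma hecke_prod_decr i m t w : (i + m = N.+1)%N -> fixes i w -> decr_from i w ->
  hecke_prod (iota i m) t (delta1 N R) w = \prod_(i <= q < N.+1) t q ^+ (N - q).
Proof.
elim: m i w => [|m IH] i w him hfix hdec.
  rewrite addn0 in him; subst i.
  by rewrite /= big_geq // (fixes_all hfix) ffunE eqxx.
rewrite /= big_ltn; last by lia.
apply: hecke_row_decr => //; try lia.
- by move=> u; apply: hecke_prod_supp; lia.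
- by move=> u h1 h2; apply: IH => //; lia.
- by rewrite (decr_from_val _ hfix hdec); lia.
- by move=> q q' h1 h2 h3; apply: hdec => //; apply: ltnW.
Qed.

Lemma hecke_groth_decr (t : nat -> R) w : decr_from 0 w ->
  hecke_groth N t w = \prod_(q < N.+1) t q ^+ (N - q).
Proof.
by move=> h; rewrite /hecke_groth hecke_prod_decr // big_mkord.
Qed.

End LongestElement.

(** At [w], the symmetry says that [F w] is fixed by [s]; at [gen N j * w], it gives a linear
    relation that rearranges to the divided difference. *)
Lemma heckeh_r_recursion N (R : comNzRingType) (s : {rmorphism R -> R}) (x y : R)
    (F F' : {ffun 'S_N.+1 -> R}) j w : (j < N)%N ->
  s y = x -> (forall u, s (F u) = F' u) ->
  heckeh_r j y F = heckeh_r j x F' -> (val_at w j < val_at w j.+1)%N ->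
  (x - y) * F w = (1 - y) * F (gen N j * w)%g - s ((1 - y) * F (gen N j * w)%g).
Proof.
move=> hj sy sF sym hw.
have e1 := congr1 (fun F : {ffun _ -> _} => F w) sym.
have e2 := congr1 (fun F : {ffun _ -> _} => F (gen N j * w)%g) sym.
rewrite !ffunE -!sF in e1 e2.
rewrite mulgA genK mul1g !permM {1 2 4 5}/gen !tpermL !tpermR in e2.
rewrite -!/(val_at _ _) hw in e1 e2; move: e1; rewrite ltnNge (ltnW hw) /= !mulr0 !addr0 => e1.
rewrite -e1 in e2.
rewrite rmorphM rmorphB rmorph1 sy.
move: e2; set a := F w; set b := F _; set c := s b => e2.
have -> : (1 - y) * b = b + y * (a - b) - y * a by ring.
by rewrite e2; ring.
Qed.

(** * Identification with the recursive definition *)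

Section Recursion.
Variable N : nat.
Notation poly := {mpoly int[N.+1]}.
Implicit Types (w : 'S_N.+1) (j : nat).

Definition gr w : poly := hecke_groth N (fun i => 'X_(inord i)) w.

Lemma nxt_inord j : (j < N)%N -> nxt (inord j : 'I_N.+1) = inord j.+1.
Proof.
move=> hj; apply: val_inj; rewrite /nxt val_insubd /= !inordK //; last exact: ltnW.
by rewrite ltnS hj.
Qed.

Lemma msym_X (i : 'I_N.+1) (s : 'S_N.+1) : msym s 'X_i = 'X_(s i) :> poly.
Proof.
rewrite msymX; congr 'X_[_]; apply/mnmP=> k; rewrite mnmE !mnm1E.
by rewrite (canF_eq (permK s)).
Qed.

Lemma gr_recursion j w : (j < N)%N -> (val_at w j < val_at w j.+1)%N ->
  ('X_(inord j) - 'X_(inord j.+1)) * gr w =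
  (1 - 'X_(inord j.+1)) * gr (gen N j * w) -
  msym (gen N j) ((1 - 'X_(inord j.+1)) * gr (gen N j * w)).
Proof.
move=> hj hw.
pose t i : poly := 'X_(inord i).
pose t' i : poly := msym (gen N j) (t i).
have t'X i k : gen N j (inord i) = inord k -> t' i = t k.
  by move=> e; rewrite /t' /t -e; exact: msym_X.
have t'j : t' j = t j.+1.
  by apply: t'X; rewrite gen_inord ?eqxx // ltnW.
have t'j1 : t' j.+1 = t j.
  by apply: t'X; rewrite gen_inord // eqxx ifF //; lia.
have H1 u : msym (gen N j) (hecke_groth N t u) = hecke_groth N t' u.
  exact: rmorph_hecke_groth.
have H2 : heckeh_r j (t j.+1) (hecke_groth N t) = heckeh_r j (t j) (hecke_groth N t').
  rewrite -t'j1; apply: (hecke_groth_sym hj); [exact/esym|exact/esym|].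
  move=> i hi n1 n2; apply/esym/t'X.
  by rewrite gen_inord // (negbTE n1) (negbTE n2).
exact: (heckeh_r_recursion hj t'j1 H1 H2 hw).
Qed.

Lemma mpolyX_inord_neq j : (j < N)%N -> 'X_(inord j) - 'X_(inord j.+1) != 0 :> poly.
Proof.
move=> hj; rewrite subr_eq0; apply/eqP=> /(congr1 (mcoeff U_(inord j))).
rewrite !mcoeffXU eqxx eq_sym inord_inj //; last exact: ltnW.
by rewrite ltn_eqF.
Qed.

(** The quotient picked by [epsilon] is unique because polynomials over [int] form a domain. *)
Lemma ddiff_eq (j : 'I_N.+1) (f g : poly) : 'X_j - 'X_(nxt j) != 0 :> poly ->
  ('X_j - 'X_(nxt j)) * g = f - swapv j f -> ddiff j f = g.
Proof.
move=> n0 hg; apply: (mulfI n0); rewrite hg.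
exact: (@epsilon_spec _ (inhabits 0) (fun g : poly => ('X_j - 'X_(nxt j)) * g = _)
  (ex_intro _ g hg)).
Qed.

Lemma rsj_inord w j : (j < N)%N -> rsj w (inord j) = (gen N j * w)%g.
Proof. by move=> hj; rewrite /rsj nxt_inord. Qed.

Lemma ddiffbar_gr j w : (j < N)%N -> (val_at w j < val_at w j.+1)%N ->
  ddiffbar (inord j) (gr (gen N j * w)) = gr w.
Proof.
move=> hj hw; apply: ddiff_eq; rewrite !nxt_inord //; first exact: mpolyX_inord_neq.
by rewrite /swapv nxt_inord //; exact: gr_recursion.
Qed.

Definition noninv w := [set ij : 'I_N.+1 * 'I_N.+1 | (ij.1 < ij.2)%N && (w ij.1 < w ij.2)%N].

(** The exchange of positions maps the noninversions of [gen N j * w] injectively to those of [w]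
    and misses the exchanged pair itself. *)
Lemma noninv_gen j w : (j < N)%N -> (val_at w j < val_at w j.+1)%N ->
  (#|noninv (gen N j * w)| < #|noninv w|)%N.
Proof.
move=> hj hw.
pose s := fun ij : 'I_N.+1 * 'I_N.+1 => (gen N j ij.1, gen N j ij.2).
have s_inj : injective s by move=> [a b] [c d] [] /perm_inj -> /perm_inj ->.
rewrite -(card_imset _ s_inj).
have h0 : (inord j, inord j.+1) \in noninv w.
  by rewrite inE /= !inordK ?ltnS ?(ltnW hj) //= leqnn; exact: hw.
rewrite (cardsD1 (inord j, inord j.+1) (noninv w)) h0 add1n ltnS.
apply/subset_leq_card/subsetP=> _ /imsetP[[a b] + ->].
rewrite !inE /= !permM => /andP[hab hw'].
have hsab : (gen N j a < gen N j b)%N.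
  case E : ((a == j :> nat) && (b == j.+1 :> nat)).
    case/andP: E => /eqP ea /eqP eb; move: hw'.
    rewrite -(inord_val a) -(inord_val b) ea eb /gen tpermL tpermR.
    by rewrite ltnNge (ltnW hw).
  by move: E hab; rewrite !gen_val //; repeat case: eqP => ? /=; lia.
rewrite hsab hw' !andbT; apply/eqP=> -[e1 e2].
have := hab; have ea : a = gen N j (inord j) by rewrite -e1 -permM genK perm1.
have eb : b = gen N j (inord j.+1) by rewrite -e2 -permM genK perm1.
rewrite ea eb /gen tpermL tpermR !inordK //; last exact: ltnW.
by rewrite ltnNge leqnSn.
Qed.

Lemma no_ascent_decr w : (forall j, (j < N)%N -> (val_at w j.+1 < val_at w j)%N) ->
  decr_from 0 w.
Proof.
move=> h q q' _; elim: q' => // q' IH; rewrite ltnS leq_eqVlt => /orP[/eqP->|hq] hN.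
  exact: h.
exact: ltn_trans (h _ hN) (IH hq (ltnW hN)).
Qed.

Lemma gr_decr w : decr_from 0 w -> gr w = xdelta N.+1.
Proof.
move=> h; rewrite /gr hecke_groth_decr // /xdelta mpolyXE_id.
by apply: eq_bigr => i _; rewrite mnmE inord_val subn1.
Qed.

Lemma groth_gr w : groth w = gr w.
Proof.
rewrite /groth.
(* The fuel bounds the number of noninversions, so it runs out only at a permutation without
   ascents. *)
have : (#|noninv w| <= N.+1 * N.+1)%N.
  by rewrite (leq_trans (max_card _)) // card_prod card_ord.
elim: (N.+1 * N.+1)%N w => [|k IH] w hk /=.
  rewrite gr_decr //; apply: no_ascent_decr => j hj; rewrite ltnNge leq_eqVlt.
  apply/negP=> /orP[/eqP/val_at_inj|]; first by lia.
  by move=> /(noninv_gen hj); lia.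
case: pickP => [j /andP[hj hw]|h].
  have hjN : (j < N)%N by [].
  have hw' : (val_at w j < val_at w j.+1)%N.
    by rewrite /val_at inord_val -nxt_inord // inord_val.
  rewrite IH; first by rewrite -[j in LHS]inord_val rsj_inord // ddiffbar_gr.
  rewrite -[j]inord_val rsj_inord //.
  by have := noninv_gen hjN hw'; lia.
rewrite gr_decr //; apply: no_ascent_decr => j hj; rewrite ltnNge leq_eqVlt.
have hjN : ((inord j : 'I_N.+1) < N)%N by rewrite inordK // ltnW.
apply/negP=> /orP[/eqP/val_at_inj|hw]; first by lia.
by have := h (inord j); rewrite /ascent ltnS hjN nxt_inord // hw.
Qed.

End Recursion.

Lemma mcoeffXM n (R : comNzRingType) (i : 'I_n) (p : {mpoly R[n]}) m :
  ('X_i * p)@_m = if (0 < m i)%N then p@_(m - U_(i)) else 0.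
Proof.
case: ifP => hm.
  have {1}-> : m = (U_(i) + (m - U_(i)))%MM.
    by apply/mnmP=> k; rewrite mnmDE mnmBE mnm1E; case: eqP => [<-|_] /=; lia.
  by rewrite mulrC mcoeffMX.
rewrite mcoeffM big1 // => -[k1 k2] /= /eqP e; rewrite mcoeffX.
case: eqP => [e1|_]; last by rewrite mul0r.
exfalso; move: (congr1 (fun k : 'X_{1..n} => k i) e).
by rewrite /= mnmDE -e1 mnm1E eqxx => h; rewrite h in hm.
Qed.

(** * Alternation of signs *)

Section Signs.
Variable N : nat.
Notation poly := {mpoly int[N.+1]}.
Implicit Types (w : 'S_N.+1) (F : {ffun 'S_N.+1 -> poly}) (i j k : nat) (m : 'X_{1..N.+1}).

(** In [w + mdeg m] the permutation is coerced to its parity, which is the parity of its length. *)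
Definition signed F := forall w m, 0 <= (-1) ^+ (w + mdeg m)%N * (F w)@_m.

Lemma odd_mulgen w k : (k < N)%N -> odd_perm (w * gen N k)%g = ~~ odd_perm w.
Proof.
move=> hk; rewrite odd_permM odd_tperm inord_inj //; last exact: ltnW.
by rewrite ltn_eqF // addbT.
Qed.

(** With signs normalised, both terms of [F (w * gen N k) - F w] count positively: the extra degree
    offsets the change of parity in one and the minus sign in the other. *)
Lemma heckeh_coef k (i : 'I_N.+1) F w m : (k < N)%N ->
  let e : int := (-1) ^+ (w + mdeg m)%N in
  e * (heckeh k 'X_i F w)@_m = e * (F w)@_m +
   (if (pos w k.+1 < pos w k)%N && (0 < m i)%N then
      (-1) ^+ ((w * gen N k)%g + mdeg (m - U_(i)))%N * (F (w * gen N k)%g)@_(m - U_(i)) +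
      (-1) ^+ (w + mdeg (m - U_(i)))%N * (F w)@_(m - U_(i)) else 0).
Proof.
move=> hk /=; rewrite !ffunE mcoeffD mcoeffXM mulrDr; congr (_ + _).
case: ifP => hm; last by rewrite andbF mulr0.
rewrite andbT; case: ifP => _; last by rewrite mcoeff0 mulr0.
have -> : mdeg m = (mdeg (m - U_(i))).+1.
  transitivity (mdeg (U_(i) + (m - U_(i)))%MM); last by rewrite mdegD mdeg1.
  by congr mdeg; apply/mnmP=> j; rewrite mnmDE mnmBE mnm1E; case: eqP => [<-|_] /=; lia.
rewrite odd_mulgen // mcoeffB addnS exprS !exprD.
by case: (odd_perm w) => /=; rewrite ?expr0 ?expr1; ring.
Qed.

Lemma signed_heckeh k (i : 'I_N.+1) F : (k < N)%N -> signed F -> signed (heckeh k 'X_i F).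
Proof.
move=> hk hF w m; rewrite heckeh_coef // addr_ge0 //.
by case: ifP => _ //; rewrite addr_ge0.
Qed.

Lemma signed_neq0 F w m : signed F ->
  ((F w)@_m != 0) = (0 < (-1) ^+ (w + mdeg m)%N * (F w)@_m).
Proof. by move=> hF; rewrite lt0r hF andbT mulf_eq0 signr_eq0. Qed.

Lemma heckeh_keep k (i : 'I_N.+1) F w m : (k < N)%N -> signed F ->
  (F w)@_m != 0 -> (heckeh k 'X_i F w)@_m != 0.
Proof.
move=> hk hF; rewrite !signed_neq0 //; last exact: signed_heckeh.
rewrite heckeh_coef // => h; apply: ltr_pwDl => //.
by case: ifP => _ //; rewrite addr_ge0.
Qed.

Lemma heckeh_cross k (i : 'I_N.+1) F w m : (k < N)%N -> signed F ->
  (pos w k.+1 < pos w k)%N -> (0 < m i)%N ->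
  (F w)@_(m - U_(i)) != 0 \/ (F (w * gen N k)%g)@_(m - U_(i)) != 0 ->
  (heckeh k 'X_i F w)@_m != 0.
Proof.
move=> hk hF hw hm; rewrite !signed_neq0 //; last exact: signed_heckeh.
rewrite heckeh_coef // hw hm => h; apply: ltr_wpDl => //.
by case: h => h; [apply: ltr_wpDl | apply: ltr_pwDl].
Qed.

Lemma signed_row i ks F : all (fun k => k < N)%N ks -> signed F ->
  signed (hecke_row ks 'X_(inord i) F).
Proof.
elim: ks F => [|k ks IH] F //= /andP[hk hks] hF.
by apply: IH => //; apply: signed_heckeh.
Qed.

Lemma signed_prod ns : signed (hecke_prod ns (fun i => 'X_(inord i)) (delta1 N _)).
Proof.
elim: ns => [|i ns IH] /=.
  move=> w m; rewrite ffunE; case: eqP => [->|_]; last by rewrite mcoeff0 mulr0.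
  rewrite mcoeff1; case: eqP => [->|_]; last by rewrite mulr0.
  by rewrite odd_perm1 mdeg0.
by apply: signed_row => //; apply/allP=> k; rewrite mem_iota; lia.
Qed.

End Signs.

(** * A pipe dream of maximal weight *)

Section Fireworks.
Variable N : nat.
Notation poly := {mpoly int[N.+1]}.
Implicit Types (w u : 'S_N.+1) (F : {ffun 'S_N.+1 -> poly}).
Implicit Types (i j k p q : nat) (m : 'X_{1..N.+1}).

(* At [p = 0] the second disjunct is false, as [0.-1 = 0]. *)
Definition starts i w p := (p == i) || (val_at w p.-1 < val_at w p)%N.

(** A run starts with its maximum, so increasing starts amount to each new start exceeding all
    earlier values from position [i] on. *)
Definition fireworks_from i w := forall q q', (i <= q)%N -> (q < q')%N -> (q' <= N)%N ->
  (val_at w q'.-1 < val_at w q')%N -> (val_at w q < val_at w q')%N.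

Definition descents_after w q :=
  count (fun p => val_at w p < val_at w p.-1)%N (iota q.+1 (N - q)).

Definition descent_mon i w : 'X_{1..N.+1} :=
  [multinom if (i <= q)%N then descents_after w q else 0%N | q < N.+1].

Section RowState.
Variables (i : nat) (w : 'S_N.+1).
Hypotheses (hi : (i <= N)%N) (hfix : fixes i w) (hfw : fireworks_from i w).

Lemma starts_lt p q : (i <= p)%N -> (p < q)%N -> (q <= N)%N -> starts i w q ->
  (val_at w p < val_at w q)%N.
Proof.
move=> hp hpq hq /orP[/eqP e|h]; first by lia.
exact: (hfw hp hpq hq h).
Qed.

Lemma run_start_exists q : (i <= q <= N)%N ->
  exists q0, [/\ (i <= q0 <= q)%N, starts i w q0 & (val_at w q <= val_at w q0)%N].
Proof.
case/andP; elim: q => [|q IH] h1 h2.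
  by exists 0%N; split; rewrite ?h1 //; apply/orP; left; rewrite eq_sym -leqn0.
case: (ltnP (val_at w q) (val_at w q.+1)) => h.
  by exists q.+1; split; rewrite ?h1 ?leqnn //; apply/orP; right.
have [e|n] := eqVneq q.+1 i.
  by exists q.+1; split; rewrite ?h1 ?leqnn // /starts e eqxx.
have [||q0 [h3 h4 h5]] := IH; try lia.
by exists q0; split => //; lia.
Qed.

Definition noninit k := ~~ starts i w (pos w k).

(* Row [i] of the pipe dream is peeled off [w] by processing the values
   [k = N - 1, ..., i] downwards.  A start of a run is skipped; for any other value
   [k] a crossing is removed, either swapping the values [k] and [k + 1] or, when
   they are adjacent in the same run (away from position [i]), leaving [u] as it
   is, so that the descent survives.  [P] is the position of the value that the
   next crossing may move. *)
Record row_state k u P : Prop := RowState {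
  st_le : (i <= k <= N)%N;
  st_P : (i <= P <= N)%N;
  st_val : val_at u P = k;
  st_low : forall q, (q <= N)%N -> (val_at w q < k)%N -> val_at u q = val_at w q;
  st_block : forall q q0, (q <= N)%N -> (i <= q0 <= N)%N -> starts i w q0 ->
    (val_at w q0 < val_at u q)%N = (val_at w q0 < val_at w q)%N;
  st_desc : forall q, (i < q < N)%N -> (val_at w q.+1 < val_at w q)%N ->
    (val_at u q.+1 < val_at u q)%N;
  st_after : forall l, (i <= l < k)%N ->
    (forall l', (l <= l' < k)%N -> noninit l') -> (P < pos w l)%N;
  st_first : (k <= val_at w i)%N -> P = i }.

(** Otherwise some start at or before the position of [l] has a value in [[l, k)], where all values
    are noninitial. *)
Lemma start_before_noninit k l : (i <= l < k)%N -> (k <= N)%N -> starts i w (pos w k) ->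
  (forall l', (l <= l' < k)%N -> noninit l') -> (pos w k < pos w l)%N.
Proof.
move=> hl hk hs hno; rewrite ltn_neqAle leqNgt; apply/andP; split.
  by apply/eqP=> /pos_inj; lia.
apply/negP=> hlt.
have hil : (i <= pos w l)%N by apply: fixes_pos => //; lia.
have [|q0 [h1 h2 h3]] := @run_start_exists (pos w l); first by rewrite hil pos_le.
have h4 : (val_at w q0 < k)%N.
  have := @starts_lt q0 (pos w k); rewrite val_at_pos ?pos_le //.
  by apply=> //; lia.
rewrite val_at_pos in h3; last by lia.
have hq0 : (q0 <= N)%N by have := pos_le w l; lia.
have := hno (val_at w q0); rewrite /noninit pos_val_at ?h2 //.
by rewrite h3 h4 => /(_ isT).
Qed.

Lemma start_first k : (i <= k <= N)%N -> starts i w (pos w k) -> (k <= val_at w i)%N ->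
  pos w k = i.
Proof.
move=> /andP[hik hk] hs hle.
have hp := fixes_pos hfix (introT andP (conj hik hk)).
apply/eqP; rewrite eqn_leq hp andbT leqNgt; apply/negP=> hlt.
by have := starts_lt (leqnn i) hlt (pos_le w k) hs; rewrite val_at_pos //; lia.
Qed.

Lemma starts_max : starts i w (pos w N).
Proof.
have hp : (i <= pos w N)%N by apply: fixes_pos; rewrite // hi leqnn.
rewrite /starts; case: eqP => //= n.
have := val_at_le w (pos w N).-1; rewrite val_at_pos // leq_eqVlt => /orP[/eqP e|//].
have : (pos w N).-1 = pos w N.
  by apply: (@val_at_inj _ w); rewrite ?val_at_pos ?pos_le //; have := pos_le w N; lia.
by lia.
Qed.

Lemma row_state_init : row_state N w (pos w N).
Proof.
split=> //; rewrite ?hi ?leqnn ?val_at_pos ?pos_le ?fixes_pos ?hi ?leqnn //.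
- by move=> l hl hno; apply: start_before_noninit => //; exact: starts_max.
- by move=> h; apply: start_first; rewrite ?hi ?leqnn //; exact: starts_max.
Qed.

Lemma row_state_skip k u P : (i <= k)%N -> starts i w (pos w k) -> row_state k.+1 u P ->
  row_state k u (pos w k).
Proof.
move=> hik hs [h1 h2 h3 h4 h5 h6 h7 h8].
have hk : (k <= N)%N by lia.
split=> //.
- by lia.
- by rewrite pos_le andbT; apply: fixes_pos => //; lia.
- by rewrite h4 ?val_at_pos ?pos_le.
- by move=> q hq hlt; apply: h4 => //; lia.
- by move=> l hl hno; apply: start_before_noninit.
- by move=> h; apply: start_first => //; lia.
Qed.

Lemma row_state_pos k u P : (i <= k)%N -> noninit k -> row_state k.+1 u P ->
  [/\ (P < pos w k)%N, pos u k = pos w k & pos u k.+1 = P].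
Proof.
move=> hik hno [h1 h2 h3 h4 h5 h6 h7 h8].
have hk : (k <= N)%N by lia.
split.
- apply: h7; first by lia.
  by move=> l' hl'; have -> : l' = k by lia.
- have e : val_at u (pos w k) = k by rewrite h4 ?val_at_pos ?pos_le.
  by rewrite -{1}e pos_val_at ?pos_le.
- by rewrite -h3 pos_val_at //; lia.
Qed.

Lemma noninit_first k : (i <= k <= N)%N -> noninit k -> (k <= val_at w i)%N ->
  (k.+1 <= val_at w i)%N.
Proof.
move=> hk hno; rewrite leq_eqVlt => /orP[/eqP e|//].
by move: hno; rewrite /noninit e pos_val_at // /starts eqxx.
Qed.

(** A swap would destroy the descent at [P], so [u] stays and [k] becomes the value to move. The
    values still constrained by [st_after] lie beyond [P], hence beyond [P.+1]. *)
Lemma row_state_keep k u P : (i <= k)%N -> noninit k -> row_state k.+1 u P ->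
  pos w k = P.+1 -> P <> i -> row_state k u (pos w k).
Proof.
move=> hik hno st hpk hPi; have [hP e1 e2] := row_state_pos hik hno st.
case: st => [h1 h2 h3 h4 h5 h6 h7 h8].
have hk : (k <= N)%N by lia.
split=> //.
- by lia.
- by rewrite pos_le andbT; apply: fixes_pos => //; lia.
- by rewrite h4 ?val_at_pos ?pos_le.
- by move=> q hq hlt; apply: h4 => //; lia.
- move=> l hl hl'; have hPl : (P < pos w l)%N.
    apply: h7; first by lia.
    move=> l' /andP[hll]; rewrite ltnS leq_eqVlt => /orP[/eqP-> //|hlk].
    by apply: hl'; rewrite hll.
  have : pos w l <> pos w k by move=> /pos_inj; lia.
  by lia.
- by move=> h; exfalso; apply/hPi/h8/noninit_first => //; lia.
Qed.

(** Only the order of [k] and [k.+1] changes. They are not adjacent in position, unless at [i],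
    where no descent has to survive; as [k] is not a start, comparisons with starts persist. *)
Lemma row_state_swap k u P : (i <= k)%N -> noninit k -> row_state k.+1 u P ->
  pos w k <> P.+1 \/ P = i -> row_state k (u * gen N k)%g P.
Proof.
move=> hik hno st hor; have [hP e1 e2] := row_state_pos hik hno st.
case: st => [h1 h2 h3 h4 h5 h6 h7 h8].
have hkN : (k < N)%N by lia.
split=> //.
- by lia.
- by rewrite val_at_mulgen // h3 eqxx ifF //; lia.
- move=> q hq hlt; rewrite val_at_mulgen // h4 //; last by lia.
  by rewrite !ifF //; lia.
- move=> q q0 hq hq0 hs; rewrite -(h5 q q0) // val_at_mulgen //.
  have : val_at w q0 <> k.
    by move=> e; move: hno; rewrite /noninit -e pos_val_at ?hs //; lia.
  by case: eqP => [->|_]; [lia|case: eqP => [->|_]; lia].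
- move=> q hq hd; have := h6 q hq hd; rewrite !val_at_mulgen //.
  have hn : ~ (val_at u q = k.+1 /\ val_at u q.+1 = k).
    move=> [a b].
    have hq1 : q = P by rewrite -e2 -a pos_val_at //; lia.
    have hq2 : q.+1 = pos w k by rewrite -e1 -b pos_val_at //; lia.
    by lia.
  by repeat case: eqP; lia.
- move=> l hl hl'; apply: h7; first by lia.
  move=> l' /andP[hll]; rewrite ltnS leq_eqVlt => /orP[/eqP-> //|hlk].
  by apply: hl'; rewrite hll.
- by move=> h; apply/h8/noninit_first => //; lia.
Qed.

Lemma row_state_last u P : row_state i u P ->
  [/\ fixes i.+1 u, fireworks_from i.+1 u &
      forall q, (i < q <= N)%N -> descents_after u q = descents_after w q].
Proof.
move=> [h1 h2 h3 h4 h5 h6 h7 h8].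
have desc p : (i.+1 < p <= N)%N ->
    (val_at u p < val_at u p.-1)%N = (val_at w p < val_at w p.-1)%N.
  move=> hp; apply/idP/idP; last first.
    move=> h; have := h6 p.-1; rewrite prednK; [|lia].
    by apply=> //; lia.
  move=> h; rewrite ltnNge leq_eqVlt; apply/negP=> /orP[/eqP/val_at_inj|hlt]; first by lia.
  (* The value of [w] at this start separates those at [p.-1] and [p], in [w] and hence, by
     [st_block], in [u]. *)
  have [|q0 [g1 g2 g3]] := @run_start_exists p.-1; first by lia.
  have hs : (val_at w q0 < val_at w p)%N by apply: hfw => //; lia.
  have b1 : (val_at w q0 < val_at u p)%N by rewrite h5 //; lia.
  have b2 : (val_at w q0 < val_at u p.-1)%N = (val_at w q0 < val_at w p.-1)%N.
    by apply: h5 => //; lia.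
  by lia.
have asc p : (i.+1 < p <= N)%N -> (val_at u p.-1 < val_at u p)%N -> 
    (val_at w p.-1 < val_at w p)%N.
  move=> hp h; have := desc p hp; have nu : val_at w p.-1 <> val_at w p.
    by move=> /val_at_inj; lia.
  by lia.
split.
- move=> q; rewrite ltnS leq_eqVlt => /orP[/eqP->|hq].
    have e : P = i.
      apply: h8; have [//|hl] := leqP i (val_at w i).
      by have := val_at_inj (val_at_le w i) hi (hfix hl); lia.
    by rewrite -{2}h3 e.
  by rewrite h4 ?hfix //; lia.
- move=> q q' hq hqq' hq' hlt.
  have hlt' : (val_at w q'.-1 < val_at w q')%N by apply: asc => //; lia.
  have [|q0 [g1 g2 g3]] := @run_start_exists q; first by lia.
  have hs : (val_at w q0 < val_at w q')%N by apply: hfw => //; lia.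
  have b1 : (val_at w q0 < val_at u q')%N by rewrite h5 //; lia.
  have b2 : (val_at w q0 < val_at u q)%N = (val_at w q0 < val_at w q)%N.
    by apply: h5 => //; lia.
  by lia.
- move=> q hq; apply: eq_in_count => p; rewrite mem_iota => hp.
  by apply: desc; lia.
Qed.

End RowState.
End Fireworks.

(** * Nonvanishing of the maximal coefficient *)

Section Existence.
Variable N : nat.
Notation poly := {mpoly int[N.+1]}.
Implicit Types (w u : 'S_N.+1) (F : {ffun 'S_N.+1 -> poly}).
Implicit Types (i j k p q : nat) (m : 'X_{1..N.+1}).

(** The monomial aimed at once the first [r] factors of row [i] are applied. *)
Definition row_mon i w r : 'X_{1..N.+1} :=
  [multinom if (q < i)%N then 0%N else if q == i :> nat
            then count (noninit i w) (iota i r) else descents_after w q | q < N.+1].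

Lemma row_mon0 i w u :
  (forall q, (i < q <= N)%N -> descents_after u q = descents_after w q) ->
  descent_mon i.+1 u = row_mon i w 0.
Proof.
move=> h; apply/mnmP=> q; rewrite !mnmE; case: ltngtP => hq //.
by apply: h; rewrite hq -ltnS ltn_ord.
Qed.

Lemma row_monS_init i w r : ~~ noninit i w (i + r) -> row_mon i w r.+1 = row_mon i w r.
Proof.
move=> /negbTE h; apply/mnmP=> q; rewrite !mnmE; case: ltngtP => // _.
by rewrite -[r.+1]addn1 iotaD count_cat /= h !addn0.
Qed.

Lemma row_monS_noninit i w r : (i <= N)%N -> noninit i w (i + r) ->
  row_mon i w r.+1 = (row_mon i w r + U_(inord i))%MM.
Proof.
move=> hi h; apply/mnmP=> q; rewrite mnmDE !mnmE.
have -> : (inord i == q) = (q == i :> nat) by rewrite -val_eqE /= inordK // eq_sym.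
have -> : count (noninit i w) (iota i r.+1) = (count (noninit i w) (iota i r) + 1)%N.
  by rewrite -[r.+1]addn1 iotaD count_cat /= h addn0.
by case: ltngtP; rewrite ?addn0.
Qed.

Lemma hecke_row_fireworks i w F : (i <= N)%N -> fixes i w -> fireworks_from i w ->
  signed F ->
  (forall u, fixes i.+1 u -> fireworks_from i.+1 u -> (F u)@_(descent_mon i.+1 u) != 0) ->
  forall r u P, row_state i w (i + r) u P ->
  (hecke_row (iota i r) 'X_(inord i) F u)@_(row_mon i w r) != 0.
Proof.
move=> hi hfix hfw hF hc; elim=> [|r IH] u P hst.
  rewrite addn0 in hst; have [h1 h2 h3] := row_state_last hi hfix hfw hst.
  by rewrite -(row_mon0 h3); apply: hc.
have hk : (i + r < N)%N by case: hst; lia.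
have hsigned : signed (hecke_row (iota i r) 'X_(inord i) F).
  by apply: signed_row => //; apply/allP=> k; rewrite mem_iota; lia.
rewrite hecke_row_rcons; rewrite addnS in hst.
have hik : (i <= i + r)%N by apply: leq_addr.
have [hno|hini] := boolP (noninit i w (i + r)); last first.
  rewrite row_monS_init //; apply: heckeh_keep => //.
  move: hini; rewrite negbK => hini.
  have st := row_state_skip hi hfix hfw hik hini hst.
  exact: IH st.
have [h1 h2 h3] := row_state_pos hi hik hno hst.
rewrite row_monS_noninit //; apply: heckeh_cross => //.
- by rewrite h2 h3.
- by rewrite mnmDE mnm1E eqxx addn1.
rewrite addmK.
(* The swapped permutation feeds the crossing, except for adjacent positions away from [i], where
   the coefficient at [u] itself does. *)
have [e|ne] := eqVneq (pos w (i + r)) P.+1; last first.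
  by right; apply: IH; apply: (row_state_swap hi hik hno hst); left; apply/eqP.
have [e'|ne'] := eqVneq P i.
  by right; apply: IH; apply: (row_state_swap hi hik hno hst); right.
by left; apply: IH; apply: (row_state_keep hi hfix hik hno hst) => //; apply/eqP.
Qed.

(** [pos w] permutes [[i, N]], so noninitial values turn into the positions that end a descent. *)
Lemma count_noninit i w : (i <= N)%N -> fixes i w ->
  count (noninit i w) (iota i (N - i)) = descents_after w i.
Proof.
move=> hi hfix.
(* The row has no factor for the value [N]; nothing is lost, as [N] starts a run. *)
have hmax : ~~ noninit i w N by rewrite negbK starts_max.
have -> : count (noninit i w) (iota i (N - i)) = count (noninit i w) (iota i (N - i).+1).
  by rewrite -[(N - i).+1]addn1 iotaD count_cat /= subnKC // (negbTE hmax) !addn0.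
rewrite -(count_map (pos w) (predC (starts i w))).
have umap : uniq (map (pos w) (iota i (N - i).+1)).
  rewrite map_inj_in_uniq ?iota_uniq // => p q; rewrite !mem_iota => hp hq.
  by apply: pos_inj; lia.
have hsub : {subset map (pos w) (iota i (N - i).+1) <= iota i (N - i).+1}.
  move=> _ /mapP[p + ->]; rewrite !mem_iota => hp.
  have h1 : (i <= pos w p)%N by apply: fixes_pos => //; lia.
  by have := pos_le w p; lia.
have /seq.permP -> : perm_eq (map (pos w) (iota i (N - i).+1)) (iota i (N - i).+1).
  apply: (uniq_perm umap (iota_uniq _ _)).
  by apply: (uniq_min_size umap hsub _).2; rewrite size_map.
rewrite /= {1}/starts eqxx add0n; apply: eq_in_count => p.
rewrite mem_iota /starts /= => hp; have -> : (p == i) = false by lia.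
by rewrite /= -leqNgt leq_eqVlt; case: eqP => // /val_at_inj; lia.
Qed.

Lemma hecke_prod_fireworks i r w : (i + r = N.+1)%N -> fixes i w -> fireworks_from i w ->
  (hecke_prod (iota i r) (fun i => 'X_(inord i)) (delta1 N _) w)@_(descent_mon i w) != 0 :> int.
Proof.
elim: r i w => [|r IH] i w hir hfix hfw.
  rewrite addn0 in hir; subst i; rewrite (fixes_all hfix) ffunE eqxx mcoeff1.
  have -> : descent_mon N.+1 1%g = 0%MM :> 'X_{1..N.+1}.
    by apply/mnmP=> q; rewrite mnmE mnm0E leqNgt ltn_ord.
  by rewrite eqxx.
have hi : (i <= N)%N by lia.
have hr : (N - i = r)%N by lia.
have -> : descent_mon i w = row_mon i w (N - i).
  apply/mnmP=> q; rewrite !mnmE; case: ltngtP => // e.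
  by rewrite e count_noninit //.
rewrite /= hr; have hst : row_state i w (i + r) w (pos w N).
  have -> : (i + r)%N = N by lia.
  exact: (row_state_init hi hfix hfw).
apply: (hecke_row_fireworks hi hfix hfw _ _ hst).
- exact: signed_prod.
by move=> u h1 h2; apply: IH => //; lia.
Qed.

End Existence.

(* Exponents of a quotient by [x_a - x_b] drop by one in [x_a]: follow the
   monomials [m, m + a - b, m + 2a - 2b, ...] of [g] to the last one. *)
Lemma msupp_divX n (R : comNzRingType) (a b : 'I_n) (g h : {mpoly R[n]}) m : a != b ->
  ('X_a - 'X_b) * g = h -> m \in msupp g ->
  exists m', [/\ m' \in msupp h, (m a < m' a)%N &
                 forall i, i != a -> i != b -> m' i = m i].
Proof.
move=> nab hg; elim: {m}(m b) {-2}m (erefl (m b)) => [|d IH] m hd hm.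
  exists (m + U_(a))%MM; split.
  - rewrite mcoeff_msupp -hg mulrBl mcoeffB !mcoeffXM !mnmDE !mnm1E eqxx (negbTE nab).
    by rewrite hd addn1 /= addmK subr0 -mcoeff_msupp.
  - by rewrite mnmDE mnm1E eqxx addn1.
  - by move=> i na nb; rewrite mnmDE mnm1E (eq_sym a) (negbTE na) addn0.
have [hm2|hm2] := boolP ((m + U_(a) - U_(b))%MM \in msupp g).
  have [|m' [h1 h2 h3]] := IH _ _ hm2.
    by rewrite mnmBE mnmDE !mnm1E eqxx (negbTE nab) hd; lia.
  exists m'; split=> //.
  - by move: h2; rewrite mnmBE mnmDE !mnm1E eqxx (eq_sym b) (negbTE nab); lia.
  - move=> i na nb; rewrite h3 // mnmBE mnmDE !mnm1E (eq_sym a) (eq_sym b).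
    by rewrite (negbTE na) (negbTE nb) addn0 subn0.
exists (m + U_(a))%MM; split.
- rewrite mcoeff_msupp -hg mulrBl mcoeffB !mcoeffXM !mnmDE !mnm1E eqxx (negbTE nab).
  rewrite addn1 hd /= addmK; move: hm2; rewrite mcoeff_msupp negbK => /eqP ->.
  by rewrite subr0 -mcoeff_msupp.
- by rewrite mnmDE mnm1E eqxx addn1.
- by move=> i na nb; rewrite mnmDE mnm1E (eq_sym a) (negbTE na) addn0.
Qed.

(** * The degree bound *)

Section DegreeBound.
Variable N : nat.
Notation poly := {mpoly int[N.+1]}.
Implicit Types (w u : 'S_N.+1).
Implicit Types (i j k p q : nat) (m : 'X_{1..N.+1}).

(** For [p > i], this says that [p] is not a left-to-right maximum of the word read from position
    [i]. *)
Definition covered i w p := has (fun q => val_at w p < val_at w q)%N (iota i (p - i)).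

Lemma coveredP i w p :
  reflect (exists q, (i <= q < p)%N /\ (val_at w p < val_at w q)%N) (covered i w p).
Proof.
apply: (iffP hasP) => [[q]|[q [h1 h2]]]; first by rewrite mem_iota => h1 h2; exists q; split; lia.
by exists q => //; rewrite mem_iota; lia.
Qed.

Definition ncovered w i := #|[set p : 'I_N.+1 | covered i w p]|.

Lemma val_at_genmul w k p : (k < N)%N -> (p <= N)%N ->
  val_at (gen N k * w)%g p = val_at w (if p == k then k.+1 else if p == k.+1 then k else p).
Proof. by move=> hk hp; rewrite /val_at permM gen_inord. Qed.

Lemma ncoveredS w k : (ncovered w k.+1 <= ncovered w k)%N.
Proof.
apply/subset_leq_card/subsetP=> p; rewrite !inE => /coveredP[q [h1 h2]].
by apply/coveredP; exists q; split; lia.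
Qed.

Section FirstAscent.
Variables (w : 'S_N.+1) (k : nat).
Hypotheses (hk : (k < N)%N) (hasc : (val_at w k < val_at w k.+1)%N).
Hypothesis hpre : forall q, (q < k)%N -> (val_at w q.+1 < val_at w q)%N.
Let w' := (gen N k * w)%g.

(** Coverings are carried along by the exchange of positions. The delicate one is that of [k.+1] by
    [k] in [w']: then [i < k], and the decreasing prefix makes [k.-1] a witness. *)
Lemma ncovered_gen_neq i : i != k -> (ncovered w' i <= ncovered w i)%N.
Proof.
move=> nik; rewrite /ncovered -(card_imset _ (@perm_inj _ (gen N k))).
apply/subset_leq_card/subsetP=> _ /imsetP[p + ->]; rewrite !inE [X in _ -> covered _ _ X]gen_val //.
have hp := ltn_ord p; rewrite ltnS in hp.
move=> /coveredP[q [h1]]; rewrite !val_at_genmul //; last by lia.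
have [e|ne] := eqVneq q k.+1.
  have -> : (p == k :> nat) = false by lia.
  have -> : (p == k.+1 :> nat) = false by lia.
  have -> : (q == k) = false by lia.
  by move=> h2; apply/coveredP; exists k.+1; split; lia.
have [ep|nep] := eqVneq (p : nat) k.+1.
  have -> : (p == k :> nat) = false by lia.
  case: (eqVneq q k) => [eq|neq] h2.
    apply/coveredP; exists k.-1; split; first by lia.
    by have := hpre (q := k.-1); rewrite prednK; [apply|]; lia.
  by apply/coveredP; exists q; split; lia.
have [ep'|nep'] := eqVneq (p : nat) k.
  case: (eqVneq q k) => [eq|neq] h2; first by lia.
  by apply/coveredP; exists q; split; lia.
case: (eqVneq q k) => [eq|neq] h2.
  by apply/coveredP; exists k.+1; split; lia.
by apply/coveredP; exists q; split; lia.
Qed.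

(** The larger value at [k.+1] in [w] replaces either exchanged position as a witness; only position
    [k.+1] may be extra. *)
Lemma ncovered_gen : (ncovered w' k <= (ncovered w k.+1).+1)%N.
Proof.
rewrite /ncovered; apply: leq_trans (_ : #|(inord k.+1 : 'I_N.+1) |: _| <= _)%N; last first.
  by apply: leq_trans (leq_card_setU _ _) _; rewrite cards1 add1n.
apply/subset_leq_card/subsetP=> p; rewrite !inE => /coveredP[q [h1]].
have hp := ltn_ord p; rewrite ltnS in hp.
have -> : (p == inord k.+1) = (p == k.+1 :> nat) by rewrite -val_eqE /= inordK.
have [//|nep] := eqVneq (p : nat) k.+1.
rewrite !val_at_genmul //; last by lia.
have -> : (p == k :> nat) = false by lia.
rewrite (negbTE nep).
case: (eqVneq q k) => [e|ne] h2; first by apply/coveredP; exists k.+1; split; lia.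
case: (eqVneq q k.+1) h2 => [e'|ne'] h2; first by apply/coveredP; exists k.+1; split; lia.
by apply/coveredP; exists q; split; lia.
Qed.

End FirstAscent.

Lemma first_ascent w k : (k < N)%N -> (val_at w k < val_at w k.+1)%N ->
  exists k', [/\ (k' < N)%N, (val_at w k' < val_at w k'.+1)%N &
    forall q, (q < k')%N -> (val_at w q.+1 < val_at w q)%N].
Proof.
move=> hk hw; have ex : exists k, (k < N)%N && (val_at w k < val_at w k.+1)%N.
  by exists k; rewrite hk hw.
case: (ex_minnP ex) => k' /andP[h1 h2] hmin; exists k'; split=> // q hq.
rewrite ltnNge leq_eqVlt; apply/negP=> /orP[/eqP/val_at_inj|h]; first by lia.
by have := hmin q; rewrite h andbT; lia.
Qed.

Lemma card_count (P : pred nat) : #|[set p : 'I_N.+1 | P p]| = count P (iota 0 N.+1).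
Proof. by rewrite cardsE cardE size_filter -val_enum_ord count_map enumT. Qed.

Lemma ncovered_count w i : (i <= N)%N ->
  ncovered w i = count (covered i w) (iota i.+1 (N - i)).
Proof.
move=> hi; rewrite /ncovered card_count.
have -> : iota 0 N.+1 = iota 0 i.+1 ++ iota i.+1 (N - i).
  by rewrite -iotaD addSn subnKC.
rewrite count_cat -[RHS]add0n; congr (_ + _)%N.
apply/eqP; rewrite -leqn0 leqNgt -has_count; apply/hasPn=> p; rewrite mem_iota => hp.
by apply/coveredP=> -[q []]; lia.
Qed.

(** Induction along first ascents. Before division, the exponents of [x_k] and [x_(k+1)] may exceed
    the bound by one; dividing by [x_k - x_(k+1)] lowers each of them. *)
Lemma gr_bound w m i : (i <= N)%N -> m \in msupp (gr w) -> (m (inord i) <= ncovered w i)%N.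
Proof.
have [d hd] := ubnP #|noninv w|; elim: d w hd m i => // d IH w hd m i hi hm.
have [/existsP[[k0 hkN] /= /andP[hk0 hasc0]]|hno] :=
  boolP [exists k : 'I_N.+1, (k < N)%N && (val_at w k < val_at w k.+1)%N]; last first.
  have hdec : decr_from 0 w.
    apply: no_ascent_decr => j hj; rewrite ltnNge leq_eqVlt; apply/negP.
    move=> /orP[/eqP/val_at_inj|h]; first by lia.
    by case/existsP: hno; exists (inord j); rewrite inordK ?hj //; lia.
  move: hm; rewrite gr_decr // msuppX inE => /eqP ->; rewrite mnmE inordK // subn1 /=.
  rewrite ncovered_count // -[X in (X <= _)%N](size_iota i.+1) -count_predT.
  apply/eq_leq/eq_in_count => p; rewrite mem_iota => hp; symmetry; apply/coveredP.
  by exists i; split; [lia|apply: hdec; lia].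
have [k [hk hasc hpre]] := first_ascent hk0 hasc0.
pose w' := (gen N k * w)%g.
have b1 j : j != k -> (ncovered w' j <= ncovered w j)%N by apply: ncovered_gen_neq.
have b2 : (ncovered w' k <= (ncovered w k.+1).+1)%N by apply: ncovered_gen.
have b3 := ncoveredS w k.
have IHw' m0 j : (j <= N)%N -> m0 \in msupp (gr w') -> (m0 (inord j) <= ncovered w' j)%N.
  by apply: IH; have := noninv_gen hk hasc; rewrite -/w'; lia.
have hg := gr_recursion hk hasc; rewrite -/w' in hg.
move: (gr w) (gr w') hg hm IHw' => g g' hg hm IHg'.
set f := (1 - 'X_(inord k.+1)) * g' in hg.
have hf m0 j : (j <= N)%N -> m0 \in msupp f ->
    (m0 (inord j) <= ncovered w' j + (j == k.+1))%N.
  move=> hj; rewrite /f mulrBl mul1r => /msuppB_le; rewrite mem_cat => /orP[h|].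
    by apply: leq_trans (IHg' _ _ hj h) _; apply: leq_addr.
  rewrite mcoeff_msupp mcoeffXM; case: ifP => // h0 h.
  have := IHg' _ _ hj; move/(_ (m0 - U_(inord k.+1))%MM); rewrite mcoeff_msupp => /(_ h).
  rewrite mnmBE mnm1E inord_inj // (eq_sym k.+1); lia.
pose D j := (ncovered w j + ((j == k) || (j == k.+1)))%N.
have hD m0 j : (j <= N)%N -> m0 \in msupp (f - msym (gen N k) f) -> (m0 (inord j) <= D j)%N.
  move=> hj /msuppB_le; rewrite mem_cat => /orP[h|].
    have := hf _ _ hj h; rewrite /D.
    have [->|nk] := eqVneq j k; first by rewrite ltn_eqF //=; lia.
    by have := b1 j nk; lia.
  rewrite mcoeff_msupp mcoeff_sym -mcoeff_msupp => h.
  have h' l : (l <= N)%N -> (m0 (gen N k (inord l)) <= ncovered w' l + (l == k.+1))%N.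
    by move=> hl; have := hf _ _ hl h; rewrite mnmE.
  have [ejk|nk] := eqVneq j k.
    have := h' k.+1 hk; rewrite gen_inord // ifF; last by lia.
    rewrite eqxx /D ejk eqxx /=; have := b1 k.+1; lia.
  have [ejk|nk1] := eqVneq j k.+1.
    have := h' k (ltnW hk); rewrite gen_inord ?eqxx; [|lia..].
    by rewrite /D ejk eqxx orbT ltn_eqF //=; lia.
  have := h' j hj; rewrite gen_inord // (negbTE nk) (negbTE nk1).
  by rewrite /D (negbTE nk) (negbTE nk1); have := b1 j nk; lia.
have nab : inord k != inord k.+1 :> 'I_N.+1 by rewrite inord_inj //; lia.
(* For [x_(k+1)] the equation is negated, so that this variable comes first in the divisor. *)
have [eik|nik] := eqVneq i k.+1.
  have hg' : ('X_(inord k.+1) - 'X_(inord k)) * g = - (f - msym (gen N k) f).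
    by rewrite -hg; ring.
  have nba : inord k.+1 != inord k :> 'I_N.+1 by rewrite eq_sym.
  have [m' [h1 h2 h3]] := msupp_divX nba hg' hm.
  have := hD m' i hi; rewrite -(perm_mem (msuppN _)) => /(_ h1).
  by move: h2; rewrite /D eik eqxx orbT; lia.
have [m' [h1 h2 h3]] := msupp_divX nab hg hm.
have := hD m' i hi h1; rewrite /D (negbTE nik) orbF.
have [eik|nik'] := eqVneq i k; first by move: h2; rewrite eik; lia.
by rewrite addn0 h3 // inord_inj //; lia.
Qed.

(** A position entered by an ascent starts a run and exceeds everything before it; one entered by a
    descent is covered by its predecessor. *)
Lemma ncovered_fireworks w i : (i <= N)%N -> fireworks_from 0 w ->
  ncovered w i = descents_after w i.
Proof.
move=> hi hfw; rewrite ncovered_count //; apply: eq_in_count => p; rewrite mem_iota => hp.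
apply/coveredP/idP => [[q [h1 h2]]|h]; last by exists p.-1; split; lia.
rewrite ltnNge leq_eqVlt; apply/negP=> /orP[/eqP/val_at_inj|h3]; first by lia.
by have := hfw q p; lia.
Qed.

(** Columns correspond to positions through [w]; the row witnessing membership of column [w p] in
    the closure is the position covering [p]. *)
Lemma wt_upclosure w (i : 'I_N.+1) : wt (upclosure (rothe w)) i = ncovered w i.
Proof.
rewrite mnmE /ncovered -[RHS](card_imset _ (@perm_inj _ w)).
apply: eq_card => j; apply/idP/imsetP.
  rewrite !inE /= => /existsP[i' /andP[h1]]; rewrite inE /= => /andP[h2 h3].
  exists (w^-1 j)%g; last by rewrite permKV.
  rewrite inE; apply/coveredP; exists i'; rewrite h1 h2 /val_at !inord_val permKV; split=> //.
move=> [p + ->]; rewrite !inE /= => /coveredP[q [h1]]; rewrite /val_at inord_val => h2.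
have hp := ltn_ord p.
apply/existsP; exists (inord q); rewrite inE /= permK h2 andbT.
by rewrite inordK //; lia.
Qed.

Lemma fireworks_fireworks_from w : fireworks w -> fireworks_from 0 w.
Proof.
move=> /forallP hfw q q' _ hqq' hq' hlt.
have hstart p : (p <= N)%N -> starts 0 w p -> run_start w (inord p).
  move=> hp /orP[/eqP->|h]; apply/orP; first by left; rewrite inordK.
  have [->|p0] := eqVneq p 0%N; first by left; rewrite inordK.
  right; apply/existsP; exists (inord p.-1); rewrite !inordK //; last by lia.
  by rewrite prednK ?eqxx; [exact: h|lia].
have [|q0 [h1 h2 h3]] := @run_start_exists N 0 w (leq0n N) q; first by lia.
apply: leq_ltn_trans h3 _.
have /forallP/(_ (inord q'))/implyP := hfw (inord q0); apply.
rewrite !hstart //; try lia; last by apply/orP; right.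
by rewrite !inordK //; lia.
Qed.

End DegreeBound.

(** * The top component *)

Lemma msupp_topcomp n (p : {mpoly int[n]}) (b : 'X_{1..n}) :
  (forall m, m \in msupp p -> (m <= b)%MM) -> b \in msupp p ->
  msupp (topcomp p) =i [:: b].
Proof.
move=> hle hb.
have hsize : (msize p).-1 = mdeg b.
  apply/eqP; rewrite eqn_leq; apply/andP; split; last first.
    by have := msize_mdeg_lt hb; lia.
  suff : (msize p <= (mdeg b).+1)%N by lia.
  rewrite msizeE; apply/bigmax_leqP_seq => m hm _; rewrite ltnS.
  by rewrite -(submK (hle m hm)) mdegD leq_addl.
(* A divisor of [x^b] of full degree is [x^b] itself. *)
have heq m : m \in msupp p -> mdeg m = mdeg b -> m = b.
  move=> hm hd; have e := submK (hle m hm); rewrite -e mdegD in hd.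
  have /eqP : mdeg (b - m) == 0%N by lia.
  by move/eqP; rewrite mdeg_eq0 => /eqP e0; rewrite -e e0 add0m.
rewrite /topcomp hsize -big_filter => x.
rewrite (perm_mem (msupp_sumX _ _)) ?filter_uniq //; last first.
  by move=> m; rewrite mem_filter mcoeff_msupp => /andP[].
rewrite mem_filter inE; apply/andP/eqP => [[/eqP h1 h2]|->]; first exact: heq.
by rewrite eqxx.
Qed.

Theorem theorem3p14 (n : nat) (w : 'S_n) :
  fireworks w ->
  msupp (topcomp (groth w)) =i [:: wt (upclosure (rothe w))].
Proof.
case: n w => [|N] w hw.
  (* For [n = 0] there are no variables and the polynomial is the empty monomial. *)
  apply: msupp_topcomp => [m _|]; first by apply/mnm_lepP => -[].
  by rewrite /groth /= msuppX inE; apply/eqP/mnmP => -[].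
have hfw := fireworks_fireworks_from hw.
apply: msupp_topcomp; rewrite groth_gr.
  move=> m hm; apply/mnm_lepP=> i; rewrite wt_upclosure.
  by have := gr_bound (ltn_ord i : i <= N)%N hm; rewrite inord_val.
have -> : wt (upclosure (rothe w)) = descent_mon 0 w.
  apply/mnmP=> i; rewrite wt_upclosure mnmE /= ncovered_fireworks //.
  exact: (ltn_ord i).
rewrite mcoeff_msupp; apply: hecke_prod_fireworks => //.
Qed.
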